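(* Let $\lambda$ be a nonzero real number and $r\ge0$ an integer. For every integer $n\ge 0$ and every real $x$, $$\mathrm{LB}_{n,\lambda}^{(r)}(x)=e^{-\frac{x}{\lambda}}\sum_{k=0}^{\infty}\frac{\langle \lambda k+r\rangle_{n,\lambda}}{k!}\Big(\frac{x}{\lambda}\Big)^{k}.$$
   Context: For nonzero real $\lambda$, the degenerate falling and rising factorials are $(x)_{0,\lambda}=1$, $(x)_{n,\lambda}=x(x-\lambda)\cdots(x-(n-1)\lambda)$ and $\langle x\rangle_{0,\lambda}=1$, $\langle x\rangle_{n,\lambda}=x(x+\lambda)\cdots(x+(n-1)\lambda)$ for $n\ge1$. The $\lambda$-analogues of the $r$-Lah numbers, $L_\lambda^r(n,k)$ ($0\le k\le n$), are defined by the polynomial identity $\langle x+r\rangle_{n,\lambda}=\sum_{k=0}^n L_\lambda^r(n,k)(x)_{k,\lambda}$ for $n\ge0$. The $\lambda$-analogue of the $r$-Lah-Bell polynomials is $\mathrm{LB}_{n,\lambda}^{(r)}(x)=\sum_{k=0}^n L_\lambda^r(n,k)x^k$ for $n\ge0$. *)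

(* Defs.v *)
From mathcomp Require Import all_boot all_order all_algebra.
From mathcomp Require Import ring.
Set Implicit Arguments.
Unset Strict Implicit.
Unset Printing Implicit Defensive.
Import GRing.Theory.
Local Open Scope ring_scope.

(* Stated over any commutative ring so that they apply both to real numbers
   and, with the constant polynomial lam%:P as step, to the indeterminate 'X. *)
Definition dfalling (A : comNzRingType) (lam x : A) (n : nat) : A :=
  \prod_(i < n) (x - i%:R * lam).

Definition drising (A : comNzRingType) (lam x : A) (n : nat) : A :=
  \prod_(i < n) (x + i%:R * lam).

(* L n k is only constrained for k <= n; [is_rLah_exists] and [is_rLah_unique]
   below show that the identity determines exactly these values. *)
Definition is_rLah (R : comNzRingType) (lam : R) (r : nat)
    (L : nat -> nat -> R) : Prop :=
  forall n : nat,
    drising lam%:P ('X + r%:R) n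
    = \sum_(k < n.+1) L n k *: dfalling lam%:P 'X k.

Definition rLahBell (R : comNzRingType) (L : nat -> nat -> R) (n : nat) :
    {poly R} :=
  \poly_(k < n.+1) L n k.

Lemma is_rLah_exists (R : comNzRingType) (lam : R) (r : nat) :
  exists L : nat -> nat -> R, is_rLah lam r L.
Proof.
pose step n (f : nat -> R) k :=
  (if k is j.+1 then f j else 0) + (r%:R + (n + k)%:R * lam) * f k.
pose L := fix L n := if n is m.+1 then step m (L m) else fun k => (k == 0)%:R.
have L0 n k : (n < k)%N -> L n k = 0.
  elim: n k => [|n IHn] [|k] //= ltnk.
  by rewrite /step !IHn ?mulr0 ?addr0 // ltnW.
exists L; elim=> [|n IHn].
  by rewrite /drising /dfalling big_ord0 big_ord1 big_ord0 /= scale1r.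
rewrite /drising big_ord_recr /= -/(drising _ _ _) IHn.
have -> : \sum_(k < n.+2) step n (L n) k *: dfalling lam%:P 'X k
  = \sum_(k < n.+1) L n k *: dfalling lam%:P 'X k.+1
  + \sum_(k < n.+1) ((r%:R + (n + k)%:R * lam) * L n k)
                    *: dfalling lam%:P 'X k.
  under eq_bigr do rewrite /step scalerDl.
  rewrite big_split /=; congr (_ + _).
    by rewrite big_ord_recl /= scale0r add0r.
  by rewrite big_ord_recr /= (L0 n n.+1) // mulr0 scale0r addr0.
rewrite mulr_suml -big_split /=; apply: eq_bigr => k _.
rewrite {2}/dfalling big_ord_recr /= -/(dfalling _ _ _).
rewrite (mulrC _ (L n k)) -scalerA -scalerDr -scalerAl; congr (_ *: _).
rewrite -mul_polyC (mulrC (_%:P)) -mulrDr; congr (_ * _).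
rewrite polyCD polyCM !polyC_natr natrD mulrDl.
ring.
Qed.

Lemma size_dfalling (R : comNzRingType) (lam : R) (k : nat) :
  dfalling lam%:P 'X k \is monic /\ size (dfalling lam%:P 'X k) = k.+1.
Proof.
have E : dfalling lam%:P 'X k = \prod_(i < k) ('X - (i%:R * lam)%:P).
  by apply: eq_bigr => i _; rewrite polyCM polyC_natr.
rewrite E; split; first exact: monic_prod_XsubC.
by rewrite size_prod_XsubC /index_enum -enumT size_enum_ord.
Qed.

Lemma is_rLah_unique (R : comNzRingType) (lam : R) (r : nat)
    (L1 L2 : nat -> nat -> R) :
  is_rLah lam r L1 -> is_rLah lam r L2 ->
  forall n k : nat, (k <= n)%N -> L1 n k = L2 n k.
Proof.
move=> H1 H2 n.
have H : \sum_(k < n.+1) (L1 n k - L2 n k) *: dfalling lam%:P 'X k = 0.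
  under eq_bigr do rewrite scalerBl.
  by rewrite sumrB -H1 -H2 subrr.
suff {H1 H2 H} K m : \sum_(k < m) (L1 n k - L2 n k) *: dfalling lam%:P 'X k = 0
    -> forall k, (k < m)%N -> L1 n k = L2 n k by exact: (K n.+1).
elim: m => [//|m IHm]; rewrite big_ord_recr /= => S0.
have Dm : L1 n m - L2 n m = 0.
  have /(congr1 (fun p : {poly R} => p`_m)) := S0.
  rewrite coef0 coefD coefZ coef_sum big1 => [|i _]; last first.
    by rewrite coefZ nth_default ?mulr0 // (size_dfalling lam i).2.
  have [/monicP + sz] := size_dfalling lam m.
  by rewrite lead_coefE sz /= => ->; rewrite mulr1 add0r.
move=> k; rewrite ltnS leq_eqVlt => /predU1P[->|]; first exact/subr0_eq.
by apply: IHm; rewrite Dm scale0r addr0 in S0.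
Qed.

(* Main.v *)
(** The factorial series [\sum_k k^_j / k! y^k] is the exponential series shifted
    by [j] and multiplied by [y^j], so it sums to [y^j e^y]. Evaluating the identity
    defining [L] at [lam * k], where the degenerate falling factorial is
    [lam^j k^_j], turns Dobinski's series into a finite combination of these
    with [y = x / lam]; then [lam^j y^j = x^j]. *)
Require Import Defs.
From mathcomp Require Import all_boot all_order all_algebra.
From mathcomp Require Import all_classical all_reals all_analysis.
Import GRing.Theory Num.Theory.
Import numFieldNormedType.Exports.
Local Open Scope classical_set_scope.
Local Open Scope ring_scope.

Lemma horner_dfalling (R : comNzRingType) (lam a : R) (n : nat) :
  (dfalling lam%:P 'X n).[a] = dfalling lam a n.
Proof.
rewrite /dfalling horner_prod; apply: eq_bigr => i _.
by rewrite -polyC_natr -polyCM hornerXsubC.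
Qed.

Lemma horner_drising (R : comNzRingType) (lam a : R) (r n : nat) :
  (drising lam%:P ('X + r%:R) n).[a] = drising lam (a + r%:R) n.
Proof.
rewrite /drising horner_prod; apply: eq_bigr => i _.
by rewrite -!polyC_natr -polyCM !hornerD hornerX !hornerC.
Qed.

Lemma drising_rLah (R : comNzRingType) (lam a : R) (r n : nat)
    (L : nat -> nat -> R) :
  is_rLah lam r L ->
  drising lam (a + r%:R) n = \sum_(j < n.+1) L n j * dfalling lam a j.
Proof.
move=> LP; rewrite -horner_drising LP horner_sum.
by apply: eq_bigr => j _; rewrite hornerZ horner_dfalling.
Qed.

Lemma dfallingM_nat (R : comNzRingType) (lam : R) (k n : nat) :
  dfalling lam (lam * k%:R) n = lam ^+ n * (k ^_ n)%:R.
Proof.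
elim: n => [|n IHn]; first by rewrite /dfalling big_ord0 ffactn0 mulr1.
rewrite /dfalling big_ord_recr /= -/(dfalling _ _ _) IHn ffactnSr exprSr.
(* The new factor [k - n] is a truncated subtraction, faithful only for [n <= k]; when [k < n] both
   sides vanish because [k ^_ n] is already 0. *)
have [lekn|ltkn] := leqP n k; last by rewrite ffact_small // !(mulr0, mul0r).
by rewrite natrM natrB // [n%:R * lam]mulrC -mulrBr mulrACA.
Qed.

Lemma cvg_series_ffact (R : realType) (y : R) (j : nat) :
  series (fun k => (k ^_ j)%:R / k`!%:R * y ^+ k) @ \oo --> y ^+ j * expR y.
Proof.
(* The first [j] terms are zero, so the partial sum of length [n + j] is exactly [y ^+ j] times the
   exponential partial sum of length [n]. *)
rewrite -(cvg_shiftn j).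
have -> : (fun n => series (fun k => (k ^_ j)%:R / k`!%:R * y ^+ k) (n + j)%N)
    = (fun n => y ^+ j * series (exp_coeff y) n).
  apply/funext => n; rewrite /series /= (big_cat_nat (n := j)) ?leq_addl //=.
  rewrite [X in X + _]big1_seq ?add0r => [|k]; last first.
    by rewrite mem_index_iota => /andP[_ /ffact_small ->]; rewrite !mul0r.
  rewrite -{1}[j]add0n big_addn addnK mulr_sumr; apply: eq_bigr => k _.
  rewrite /exp_coeff /= exprD [y ^+ k * _]mulrC [RHS]mulrA [RHS]mulrC; congr (_ * _).
  (* Since [(k + j)! = (k + j) ^_ j * k!] with a nonzero first factor, the coefficient reduces to
     [1 / k!]. *)
  have := ffact_fact (leq_addl k j); rewrite addnK => <-.
  have nz m : m`!%:R != 0 :> R by rewrite pnatr_eq0 -lt0n fact_gt0.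
  have nzf : (((k + j) ^_ j)%N)%:R != 0 :> R.
    by rewrite pnatr_eq0 -lt0n ffact_gt0 leq_addl.
  by rewrite natrM invfM mulrA divff // mul1r.
by apply: cvgMl_tmp; exact: is_cvg_series_exp_coeff.
Qed.

Theorem theorem3p3 (R : realType) (lam : R) (r : nat) (L : nat -> nat -> R)
    (lam_neq0 : lam != 0) (L_rLah : is_rLah lam r L) (n : nat) (x : R) :
  let u : R^nat := fun k =>
    drising lam (lam * k%:R + r%:R) n / k`!%:R * (x / lam) ^+ k in
  cvgn (series u) /\
  (rLahBell L n).[x] = expR (- (x / lam)) * limn (series u).
Proof.
move=> u; set y := x / lam.
pose v j : R^nat := fun k => (k ^_ j)%:R / k`!%:R * y ^+ k.
(* The sums are exchanged on partial sums, where both are finite, so no rearrangement of an infinite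
   series occurs. *)
have uE : series u =
    (fun N => \sum_(j < n.+1) L n j * lam ^+ j * series (v j) N).
  apply/funext => N; rewrite /series /=.
  under [RHS]eq_bigr do rewrite mulr_sumr.
  rewrite exchange_big /=; apply: eq_bigr => k _.
  rewrite /u (drising_rLah _ _ _ _ _ _ L_rLah) !mulr_suml.
  by apply: eq_bigr => j _; rewrite dfallingM_nat /v -/y !mulrA.
have cvu : series u @ \oo --> (rLahBell L n).[x] * expR y.
  rewrite uE horner_poly mulr_suml.
  apply: cvg_big => [z|j _]; first exact: add_continuous.
  have -> : L n j * x ^+ j * expR y = L n j * lam ^+ j * (y ^+ j * expR y).
    (* [lam_neq0] enters here, to recover [x] from [y = x / lam]. *)
    by have -> : x = lam * y; [rewrite mulrC divfK | rewrite exprMn !mulrA].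
  by apply: cvgMl_tmp; exact: cvg_series_ffact.
(* The explicit limit gives convergence and, once multiplied by [expR (- y)], the formula. *)
split; first by apply/cvg_ex; exists ((rLahBell L n).[x] * expR y).
by rewrite (cvg_lim _ cvu) // mulrCA -expRD addNr expR0 mulr1.
Qed.
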